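(* Let $f=\frac1n\sum_{i=1}^n f_i$. Assume that $f$ satisfies the Polyak-Lojasiewicz (PL) condition with constant $\mu>0$, that is, $$\|\nabla f(x)\|^2\ge 2\mu\,(f(x)-f^* )\quad\text{for all }x\in\mathbb{R}^d,$$ and let $f$ and the $f_i$ be smooth functions (the $f_i$ are not assumed convex), with smoothness constants $L$ and $L_i$ respectively, and $L_{\max}=\max\{L_i\}_{i=1}^n$. Then SGD with $\text{SPS}_{\max}$ with $c>\frac{L_{\max}}{4\mu}$ and $\gamma_b\ge\frac{1}{2cL_{\max}}$ converges as $$\mathbb{E}[f(x^k)-f(x^* )]\le\nu^k\,[f(x^0)-f(x^* )]+\frac{L\sigma^2\gamma_b}{2(1-\nu)\,c},$$ where $\nu=\gamma_b\left(\frac1\alpha-2\mu+\frac{L_{\max}}{2c}\right)\in(0,1]$ and $\alpha=\min\left\{\frac{1}{2cL_{\max}},\gamma_b\right\}$.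
   Context: The problem is to minimize $f(x)=\frac1n\sum_{i=1}^n f_i(x)$ over $x\in\mathbb{R}^d$. The set of minimizers of $f$ is assumed nonempty, $x^*$ is a minimizer and $f^*=f(x^* )$ is the minimum value. For each $i$, $f_i^*:=\inf_x f_i(x)$. It is assumed throughout that the optimal objective difference $\sigma^2:=\mathbb{E}_i[f_i(x^* )-f_i^*]=f(x^* )-\mathbb{E}_i[f_i^*]$ is finite, where $\mathbb{E}_i$ is expectation over $i$ uniform in $\{1,\dots,n\}$. A function is smooth with constant $L$ ($L$-smooth) if its gradient is $L$-Lipschitz. SGD: $x^{k+1}=x^k-\gamma_k\nabla f_i(x^k)$, starting from $x^0$, where at each iteration $k$ the index $i\in\{1,\dots,n\}$ is chosen uniformly at random and $\gamma_k>0$ is the step-size. $\text{SPS}_{\max}$ (bounded stochastic Polyak step-size) with parameters $c>0$ and $\gamma_b>0$: $\gamma_k=\min\left\{\frac{f_i(x^k)-f_i^*}{c\,\|\nabla f_i(x^k)\|^2},\,\gamma_b\right\}$, where $i$ is the index chosen at iteration $k$.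
   Formalization: The condition ν∈(0,1] is taken as a hypothesis, since it does not follow from the others (n=1, f=x²/2, μ=L=1, c=1, γ_b=10 gives ν=5); at ν=1 the residual term is read as +∞, or as 0 if Lσ²=0. *)

(* Defs.v *)
From HB Require Import structures.
From mathcomp Require Import all_boot all_order all_algebra.
From mathcomp Require Import all_classical all_reals all_analysis.

Set Implicit Arguments.
Unset Strict Implicit.
Unset Printing Implicit Defensive.

Import Order.TTheory GRing.Theory Num.Theory.
Import numFieldNormedType.Exports.

Local Open Scope classical_set_scope.
Local Open Scope ring_scope.

(* The library norm `|x| on 'rV[R]_d is the max norm, hence this one. *)
Definition enorm (R : realType) (d : nat) (x : 'rV[R]_d) : R :=
  Num.sqrt (\sum_(j < d) x 0 j ^+ 2).

Definition grad (R : realType) (d : nat) (g : 'rV[R]_d -> R) (x : 'rV[R]_d) :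
    'rV[R]_d :=
  \row_(j < d) 'D_(delta_mx 0 j) g x.

Definition smooth (R : realType) (d : nat) (L : R) (g : 'rV[R]_d -> R) : Prop :=
  (forall x, differentiable g x) /\
  (forall x y, enorm (grad g x - grad g y) <= L * enorm (x - y)).

Definition minimizer (R : realType) (d : nat) (g : 'rV[R]_d -> R)
    (xstar : 'rV[R]_d) : Prop :=
  forall x, g xstar <= g x.

Definition PL (R : realType) (d : nat) (mu : R) (g : 'rV[R]_d -> R) (gstar : R) :
    Prop :=
  forall x, enorm (grad g x) ^+ 2 >= 2 * mu * (g x - gstar).

(* Finite families are indexed by 'I_n.+1 (n.+1 functions), so that they are
   nonempty. *)
Definition average (R : realType) (d n : nat) (f : 'I_n.+1 -> 'rV[R]_d -> R)
    (x : 'rV[R]_d) : R :=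
  n.+1%:R^-1 * \sum_(i < n.+1) f i x.

Definition maxL (R : realType) (n : nat) (Ls : 'I_n.+1 -> R) : R :=
  \big[Num.max/Ls ord0]_(i < n.+1) Ls i.

(* Extended-real: -oo when g is not bounded below. *)
Definition infval (R : realType) (d : nat) (g : 'rV[R]_d -> R) : \bar R :=
  ereal_inf (range (fun x => (g x)%:E)).

(* Extended-real; finite exactly when every f i is bounded below. *)
Definition sigma2 (R : realType) (d n : nat) (f : 'I_n.+1 -> 'rV[R]_d -> R)
    (xstar : 'rV[R]_d) : \bar R :=
  ((n.+1%:R^-1)%:E * \sum_(i < n.+1) ((f i xstar)%:E - infval (f i)))%E.

(* At a stationary point of g the Polyak quotient has a zero denominator; it is
   read as +oo, so the step-size is gb there.  The SGD iterates do not depend on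
   this choice, since the step-size is then multiplied by a zero gradient.
   [fine] is the identity when g is bounded below. *)
Definition SPSmax (R : realType) (d : nat) (c gb : R) (g : 'rV[R]_d -> R)
    (x : 'rV[R]_d) : R :=
  if grad g x == 0 then gb
  else Num.min ((g x - fine (infval g)) / (c * enorm (grad g x) ^+ 2)) gb.

Fixpoint sgd (R : realType) (d n : nat) (T : Type)
    (f : 'I_n.+1 -> 'rV[R]_d -> R) (step : 'I_n.+1 -> 'rV[R]_d -> R)
    (idx : nat -> T -> 'I_n.+1) (x0 : 'rV[R]_d) (k : nat) (w : T) : 'rV[R]_d :=
  if k is k'.+1 then
    let x := sgd f step idx x0 k' w in
    x - step (idx k' w) x *: grad (f (idx k' w)) x
  else x0.

(* Random variables valued in 'I_n.+1 with its discrete sigma-algebra. *)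
Definition iid_uniform (R : realType) (disp : measure_display)
    (T : measurableType disp) (P : probability T R) (n : nat)
    (idx : nat -> T -> 'I_n.+1) : Prop :=
  [/\ forall k (A : set 'I_n.+1), measurable (idx k @^-1` A),
      forall k i, P (idx k @^-1` [set i]) = (n.+1%:R^-1)%:E
    & forall (J : seq nat) (A : nat -> set 'I_n.+1), uniq J ->
        P (\bigcap_(k in [set` J]) (idx k @^-1` A k)) =
        (\prod_(k <- J) P (idx k @^-1` A k))%E].

(* Main.v *)
Require Import Defs.
From HB Require Import structures.
From mathcomp Require Import all_boot all_order all_algebra.
From mathcomp Require Import all_classical all_reals all_analysis.
From mathcomp Require Import measurable_realfun ring lra.

Set Implicit Arguments.
Unset Strict Implicit.
Unset Printing Implicit Defensive.

Import Order.TTheory GRing.Theory Num.Theory.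
Import numFieldNormedType.Exports.

Local Open Scope classical_set_scope.
Local Open Scope ring_scope.

(** One step is controlled in the worst case, and the random index is only
    averaged afterwards.  Write D(x) for f(x) minus the minimum of f, m_i for the
    infimum of f_i, g_i for the gradient of f_i at x, and s for the step-size
    used with index i at x.

    Smoothness gives the quadratic upper bound [quad_ub], hence
    D(x - s g_i) <= D(x) - s <g_i, grad f> + (l/2) s^2 |g_i|^2.  The Polyak
    quotient is chosen so that s |g_i|^2 <= (f_i(x) - m_i) / c, and it is at
    least alpha because a quadratic upper bound forces
    |g_i|^2 <= 2 Lmax (f_i(x) - m_i).  So the right-hand side is D(x) + s r,
    where r = (l/2c) (f_i(x) - m_i) - <g_i, grad f> does not involve s.  The
    sign of r is unknown, and the functions are not convex, so s is removed by
    dividing: D(x) + s r <= s (D(x)/alpha + r), and since the left end of the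
    chain, D(x - s g_i), is nonnegative, the bracket is nonnegative and s may be
    replaced by its upper bound gamma_b ([le_divD_scale]).  Averaging over i
    turns <g_i, grad f> into |grad f|^2, which the Polyak-Lojasiewicz condition
    bounds below, and f_i(x) - m_i into D(x) + sigma^2.  This is
    [average_sgd_step_le]: the mean of D over the next iterate is at most
    nu D(x) + l sigma^2 gamma_b / (2c).

    On the probabilistic side, the k-th iterate depends on the first k indices
    only, hence is independent of any event about later ones
    ([sgd_iterate_indep_future]); so the expectation of D at step k+1 is the
    expectation at step k of the average above ([expectation_sgdS]).  Iterating
    and summing the geometric series gives the bound.

    The contraction factor nu features Lmax, while the residual features L, and
    L need not be below Lmax, nor even be nonnegative when d = 0.  The one-step
    bound is therefore run with an auxiliary constant l between 0 and Lmax for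
    which f still has its quadratic upper bound and l sigma^2 <= L sigma^2
    ([exists_quad_ub_average]).  Finally, for nu = 1 the residual term is +oo
    unless L sigma^2 = 0, and in that case the recursion has no residual. *)

(** * Euclidean inner product and norm *)

Definition dotv (R : realType) (d : nat) (u v : 'rV[R]_d) : R :=
  \sum_(j < d) u 0 j * v 0 j.

Lemma dotvC (R : realType) (d : nat) (u v : 'rV[R]_d) : dotv u v = dotv v u.
Proof. by apply: eq_bigr => j _; rewrite mulrC. Qed.

Lemma dotvDl (R : realType) (d : nat) (u v w : 'rV[R]_d) :
  dotv (u + v) w = dotv u w + dotv v w.
Proof.
by rewrite /dotv -big_split; apply: eq_bigr => j _; rewrite mxE mulrDl.
Qed.

Lemma dotvZl (R : realType) (d : nat) (a : R) (u v : 'rV[R]_d) :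
  dotv (a *: u) v = a * dotv u v.
Proof. by rewrite /dotv mulr_sumr; apply: eq_bigr => j _; rewrite mxE mulrA. Qed.

Lemma dotvDr (R : realType) (d : nat) (u v w : 'rV[R]_d) :
  dotv w (u + v) = dotv w u + dotv w v.
Proof. by rewrite dotvC dotvDl !(dotvC w). Qed.

Lemma dotvZr (R : realType) (d : nat) (a : R) (u v : 'rV[R]_d) :
  dotv v (a *: u) = a * dotv v u.
Proof. by rewrite dotvC dotvZl (dotvC v). Qed.

Lemma dotv_suml (R : realType) (d n : nat) (u : 'I_n -> 'rV[R]_d)
    (v : 'rV[R]_d) :
  dotv (\sum_(i < n) u i) v = \sum_(i < n) dotv (u i) v.
Proof.
elim/big_ind2 : _ => [|a b a' b' <- <-|//]; last by rewrite dotvDl.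
by rewrite -(scale0r v) dotvZl mul0r.
Qed.

Lemma enorm_ge0 (R : realType) (d : nat) (u : 'rV[R]_d) : 0 <= enorm u.
Proof. exact: sqrtr_ge0. Qed.

Lemma enorm_sqr (R : realType) (d : nat) (u : 'rV[R]_d) :
  enorm u ^+ 2 = dotv u u.
Proof.
rewrite sqr_sqrtr; first by apply: eq_bigr => j _; rewrite expr2.
by apply: sumr_ge0 => j _; exact: sqr_ge0.
Qed.

Lemma enormZ (R : realType) (d : nat) (a : R) (u : 'rV[R]_d) :
  0 <= a -> enorm (a *: u) = a * enorm u.
Proof.
move=> a0; apply/eqP; rewrite -(@eqrXn2 _ 2) ?mulr_ge0 ?enorm_ge0 //.
by rewrite exprMn !enorm_sqr dotvZl dotvZr mulrA.
Qed.

Lemma enorm_eq0 (R : realType) (d : nat) (u : 'rV[R]_d) : enorm u = 0 -> u = 0.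
Proof.
move=> u0; apply/rowP => j; rewrite mxE; apply/eqP; rewrite -sqrf_eq0.
have : dotv u u = 0 by rewrite -enorm_sqr u0 expr0n.
move/eqP; rewrite psumr_eq0 => [|i _]; last by rewrite -expr2 sqr_ge0.
by move=> /allP /(_ j (mem_index_enum _)); rewrite -expr2.
Qed.

(** Cauchy-Schwarz, from |(|v| u - |u| v)|^2 >= 0. *)
Lemma dotv_le_enorm (R : realType) (d : nat) (u v : 'rV[R]_d) :
  dotv u v <= enorm u * enorm v.
Proof.
have [/enorm_eq0 ->|u0] := eqVneq (enorm u) 0.
  by rewrite -(scale0r v) dotvZl mul0r mulr_ge0 ?enorm_ge0.
have [/enorm_eq0 ->|v0] := eqVneq (enorm v) 0.
  by rewrite -(scale0r u) dotvZr mul0r mulr_ge0 ?enorm_ge0.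
set a := enorm u; set b := enorm v.
have ab0 : 0 < a * b by rewrite mulr_gt0 // lt_neqAle enorm_ge0 eq_sym ?u0 ?v0.
have : 0 <= dotv (b *: u + (- a) *: v) (b *: u + (- a) *: v).
  by rewrite -enorm_sqr sqr_ge0.
rewrite !(dotvDl, dotvDr, dotvZl, dotvZr) -!enorm_sqr -/a -/b (dotvC v u) => h.
rewrite -(ler_pM2l ab0); nra.
Qed.

(** * Quadratic upper bounds of smooth functions *)

Lemma derive_dotv_grad (R : realType) (d : nat) (g : 'rV[R]_d -> R)
    (x v : 'rV[R]_d) :
  differentiable g x -> 'D_v g x = dotv (grad g x) v.
Proof.
move=> dg; rewrite deriveE // {1}(row_sum_delta v) linear_sum.
by apply: eq_bigr => j _; rewrite linearZ /= mxE deriveE // mulrC.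
Qed.

(** The difference quotients of s |-> g (x + s v) at t are literally those of g
    at x + t v in the direction v. *)
Lemma is_derive_line (R : realType) (d : nat) (g : 'rV[R]_d -> R)
    (x v : 'rV[R]_d) (t : R) :
  (forall y, differentiable g y) ->
  is_derive t 1 (fun s => g (x + s *: v)) (dotv (grad g (x + t *: v)) v).
Proof.
move=> dg; rewrite -derive_dotv_grad //.
have E : (fun h : R => h^-1 *: (((fun s => g (x + s *: v)) \o shift t) (h *: 1) -
      g (x + t *: v))) =
    (fun h : R => h^-1 *: ((g \o shift (x + t *: v)) (h *: v) - g (x + t *: v))).
  apply/funext => h /=; congr (_ *: (g _ - _)).
  by rewrite [h *: 1]mulr1 scalerDl addrCA.
by split; [rewrite /derivable E; exact: diff_derivable | rewrite /derive E].
Qed.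

(** The form in which [l]-smoothness is used: being affine in g, it passes to
    averages term by term ([average_quad_ub]). *)
Definition quad_ub (R : realType) (d : nat) (l : R) (g : 'rV[R]_d -> R) : Prop :=
  forall x v, g (x + v) <= g x + dotv (grad g x) v + l / 2 * enorm v ^+ 2.

(** The descent lemma: subtracting the claimed upper bound from g along the
    segment from x to x + v leaves a nonincreasing function on [0, 1], because
    its derivative is <grad g (x + t v) - grad g x, v> - l t |v|^2, which
    Cauchy-Schwarz makes nonpositive. *)
Lemma smooth_quad_ub (R : realType) (d : nat) (l : R) (g : 'rV[R]_d -> R) :
  smooth l g -> quad_ub l g.
Proof.
move=> [dg lip] x v.
pose phi := fun t : R => g (x + t *: v) - t * dotv (grad g x) v
  - l / 2 * enorm v ^+ 2 * t ^+ 2.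
have dphi (t : R) : is_derive t 1 phi (dotv (grad g (x + t *: v)) v
    - dotv (grad g x) v - l * enorm v ^+ 2 * t).
  have := is_derive_line x v t dg => ?.
  rewrite /phi; apply: is_derive_eq.
  have scE (a b : R) : a *: b = a * b by [].
  rewrite !scE.
  by lra.
have := @ler0_derive1_le_cc R phi 0 1 _ _ _ 1 0.
rewrite !in_itv /= !lexx !ler01 => /(_ _ _ _ erefl erefl erefl).
rewrite /phi scale0r scale1r addr0 !mul0r mul1r expr0n expr1n /= mulr0 mulr1.
move=> H; suff : g (x + v) - dotv (grad g x) v - l / 2 * enorm v ^+ 2 <= g x - 0 - 0.
  by lra.
apply: H.
- by move=> t _; exact: ex_derive.
- move=> t; rewrite in_itv /= => /andP[t0 _].
  rewrite derive1E derive_val.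
  have := lip (x + t *: v) x; rewrite addrAC subrr add0r (enormZ _ (ltW t0)) => h.
  have := dotv_le_enorm (grad g (x + t *: v) - grad g x) v.
  rewrite dotvDl -[- grad g x]scaleN1r dotvZl scaleN1r.
  have := ler_wpM2r (enorm_ge0 v) h; lra.
- apply: derivable_within_continuous => t _; exact: ex_derive.
Qed.

(** A negative smoothness constant is possible only on a one-point space. *)
Lemma smooth_lt0_eq (R : realType) (d : nat) (l : R) (g : 'rV[R]_d -> R) :
  l < 0 -> smooth l g -> forall x y : 'rV[R]_d, x = y.
Proof.
move=> l0 [_ lip] x y; apply: subr0_eq; apply: enorm_eq0; apply/eqP.
rewrite eq_le enorm_ge0 andbT -(ler_nM2l l0) mulr0.
exact: le_trans (enorm_ge0 _) (lip x y).
Qed.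

Lemma quad_ub_le (R : realType) (d : nat) (l l' : R) (g : 'rV[R]_d -> R) :
  l <= l' -> quad_ub l g -> quad_ub l' g.
Proof.
move=> ll' h x v; apply: (le_trans (h x v)).
by rewrite lerD2l ler_wpM2r ?sqr_ge0 // ler_pM2r.
Qed.

(** The step v = - grad g x / l minimizes the quadratic upper bound at x, and the
    value there cannot go below the lower bound m. *)
Lemma quad_ub_grad_sqr (R : realType) (d : nat) (l m : R) (g : 'rV[R]_d -> R)
    (x : 'rV[R]_d) :
  0 < l -> quad_ub l g -> (forall y, m <= g y) ->
  enorm (grad g x) ^+ 2 <= 2 * l * (g x - m).
Proof.
move=> l0 h mg; have := h x ((- l^-1) *: grad g x).
rewrite enorm_sqr !dotvZr dotvZl -!enorm_sqr; set q := _ ^+ 2 => hq.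
have {hq} : m <= g x - q / (2 * l).
  apply: (le_trans (mg _) (le_trans hq _)); rewrite le_eqVlt; apply/orP; left.
  by apply/eqP; field; rewrite gt_eqF.
rewrite lerBrDr -lerBrDl ler_pdivrMr; last by lra.
by rewrite mulrC.
Qed.

Lemma grad_average (R : realType) (d n : nat) (f : 'I_n.+1 -> 'rV[R]_d -> R)
    (x : 'rV[R]_d) :
  (forall i, differentiable (f i) x) ->
  grad (average f) x = n.+1%:R^-1 *: \sum_(i < n.+1) grad (f i) x.
Proof.
move=> df; have E : average f = n.+1%:R^-1 \*: (\sum_(i < n.+1) f i).
  by apply/funext => y; rewrite /average /= fct_sumE.
apply/rowP => j; rewrite !mxE summxE E deriveZ.
  rewrite derive_sum; first by congr (_ * _); apply: eq_bigr => i _; rewrite mxE.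
  by move=> i; exact: diff_derivable.
by apply: derivable_sum => i; exact: diff_derivable.
Qed.

Lemma average_quad_ub (R : realType) (d n : nat) (l : R)
    (f : 'I_n.+1 -> 'rV[R]_d -> R) :
  (forall i, quad_ub l (f i)) ->
  (forall i x, differentiable (f i) x) ->
  quad_ub l (average f).
Proof.
move=> h df x v; rewrite grad_average // dotvZl {1 2}/average.
have n0 : (0 : R) < n.+1%:R by rewrite ltr0n.
rewrite -(ler_pM2l n0) !mulrDr !mulVKf ?gt_eqF //.
rewrite dotv_suml -big_split /= mulrC.
have -> : l / 2 * enorm v ^+ 2 * n.+1%:R = \sum_(i < n.+1) (l / 2 * enorm v ^+ 2).
  by rewrite sumr_const card_ord mulr_natr.
by rewrite -big_split; apply: ler_sum => i _; exact: h.
Qed.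

(** * The optimal objective difference *)

Lemma infval_le (R : realType) (d : nat) (g : 'rV[R]_d -> R) (x : 'rV[R]_d) :
  (infval g <= (g x)%:E)%E.
Proof. by apply: ereal_inf_lbound; exists x. Qed.

Lemma fine_infval_le (R : realType) (d : nat) (g : 'rV[R]_d -> R)
    (x : 'rV[R]_d) :
  infval g \is a fin_num -> fine (infval g) <= g x.
Proof. by move=> gfin; rewrite -lee_fin fineK // infval_le. Qed.

(** The differences are never -oo, so one infinite difference would make the
    whole sum +oo. *)
Lemma sigma2_fin_num (R : realType) (d n : nat) (f : 'I_n.+1 -> 'rV[R]_d -> R)
    (xstar : 'rV[R]_d) :
  sigma2 f xstar \is a fin_num -> forall i, infval (f i) \is a fin_num.
Proof.
have gapNy i : ((f i xstar)%:E - infval (f i) != -oo)%E.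
  by have := infval_le (f i) xstar; case: (infval (f i)).
move=> sfin; suff : (\sum_(i < n.+1) ((f i xstar)%:E - infval (f i)))%E
    \is a fin_num.
  move=> /sum_fin_numP sumfin i.
  have : ((f i xstar)%:E - infval (f i))%E \is a fin_num.
    exact: sumfin (mem_index_enum i) _.
  by case: (infval (f i)).
have : (\sum_(i < n.+1) ((f i xstar)%:E - infval (f i)))%E != -oo%E.
  by apply/eqP => /esum_eqNyP [i [_ _ /eqP]]; apply/negP.
move: sfin; rewrite /sigma2; case: (\sum_(i < _) _)%E => //.
by rewrite gt0_muley ?lte_fin ?invr_gt0 ?ltr0n.
Qed.

(** The real number underlying [sigma2] once every infimum is finite. *)
Definition sigma2r (R : realType) (d n : nat) (f : 'I_n.+1 -> 'rV[R]_d -> R)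
    (xstar : 'rV[R]_d) : R :=
  n.+1%:R^-1 * \sum_(i < n.+1) (f i xstar - fine (infval (f i))).

Lemma sigma2E (R : realType) (d n : nat) (f : 'I_n.+1 -> 'rV[R]_d -> R)
    (xstar : 'rV[R]_d) :
  (forall i, infval (f i) \is a fin_num) -> sigma2 f xstar = (sigma2r f xstar)%:E.
Proof.
move=> ffin; rewrite /sigma2 /sigma2r EFinM; congr (_ * _)%E.
by rewrite -sumEFin; apply: eq_bigr => i _; rewrite EFinB fineK.
Qed.

Lemma sigma2r_ge0 (R : realType) (d n : nat) (f : 'I_n.+1 -> 'rV[R]_d -> R)
    (xstar : 'rV[R]_d) :
  (forall i, infval (f i) \is a fin_num) -> 0 <= sigma2r f xstar.
Proof.
move=> ffin; rewrite mulr_ge0 ?invr_ge0 //.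
by apply: sumr_ge0 => i _; rewrite subr_ge0 fine_infval_le.
Qed.

Lemma sigma2r_eq0 (R : realType) (d n : nat) (f : 'I_n.+1 -> 'rV[R]_d -> R)
    (xstar : 'rV[R]_d) :
  (forall x y : 'rV[R]_d, x = y) -> sigma2r f xstar = 0.
Proof.
move=> eqxy; rewrite /sigma2r big1 ?mulr0 // => i _.
have -> : infval (f i) = (f i xstar)%:E; last by rewrite subrr.
apply/eqP; rewrite eq_le infval_le; apply: le_ereal_inf_tmp => _ [x _ <-].
by rewrite (eqxy xstar x).
Qed.

(** The constant l is L clipped to the interval from 0 to lm.  Clipping from
    below happens only on a one-point space, where sigma^2 vanishes; clipping
    from above decreases l sigma^2 since sigma^2 is nonnegative. *)
Lemma exists_quad_ub_average (R : realType) (d n : nat)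
    (f : 'I_n.+1 -> 'rV[R]_d -> R) (xstar : 'rV[R]_d) (L lm : R) :
  0 < lm -> quad_ub lm (average f) -> smooth L (average f) ->
  0 <= sigma2r f xstar ->
  exists l, [/\ 0 <= l, l <= lm, quad_ub l (average f)
              & l * sigma2r f xstar <= L * sigma2r f xstar].
Proof.
move=> lm0 fm fL gap0; have [L0|L0] := ltP L 0.
  have eqxy := smooth_lt0_eq L0 fL; exists 0; split=> [//||x v|].
  - exact: ltW.
  - rewrite (eqxy (x + v) x) {1}(eqxy v (0 *: v)) dotvZr.
    by rewrite !mul0r !addr0.
  - by rewrite sigma2r_eq0 // !mulr0.
have [Llm|/ltW lmL] := leP L lm.
  by exists L; split => //; exact: smooth_quad_ub.
by exists lm; split => //; [exact: ltW | rewrite ler_wpM2r].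
Qed.

(** * The bounded Polyak step-size *)

Section polyak_step.
Context (R : realType) (d : nat) (g : 'rV[R]_d -> R) (l c gb : R).
Hypotheses (l0 : 0 < l) (gl : quad_ub l g) (gfin : infval g \is a fin_num).
Hypotheses (c0 : 0 < c) (gb0 : 0 < gb).
Implicit Type x : 'rV[R]_d.

Let enorm_gt0 x : grad g x != 0 -> 0 < enorm (grad g x).
Proof.
move=> gx0; rewrite lt_neqAle enorm_ge0 andbT eq_sym.
by apply: contra gx0 => /eqP /enorm_eq0 ->.
Qed.

Lemma SPSmax_le x : SPSmax c gb g x <= gb.
Proof. by rewrite /SPSmax; case: ifP => // _; rewrite ge_min lexx orbT. Qed.

(** The Polyak quotient is at least 1 / (2 c l) by [quad_ub_grad_sqr]. *)
Lemma le_SPSmax x : 1 / (2 * c * l) <= gb -> 1 / (2 * c * l) <= SPSmax c gb g x.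
Proof.
rewrite /SPSmax; case: ifPn => // gx0 agb; rewrite le_min agb andbT.
have e0 := enorm_gt0 gx0.
rewrite ler_pdivlMr ?mulr_gt0 ?exprn_gt0 // mulrAC ler_pdivrMr ?mulr_gt0 //.
have := quad_ub_grad_sqr x l0 gl (fun y => fine_infval_le y gfin).
by move=> /(ler_wpM2l (ltW c0)); lra.
Qed.

(** The minimum with [gb] only helps, and at a stationary point the left-hand
    side vanishes whatever the step-size. *)
Lemma SPSmax_grad_sqr x :
  SPSmax c gb g x * enorm (grad g x) ^+ 2 <= (g x - fine (infval g)) / c.
Proof.
have m0 : 0 <= g x - fine (infval g) by rewrite subr_ge0 fine_infval_le.
rewrite /SPSmax; case: ifPn => [/eqP ->|gx0].
  by rewrite enorm_sqr -(scale0r 0) dotvZl mul0r mulr0 divr_ge0 // ltW.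
have e0 := enorm_gt0 gx0; set q := (_ / _).
apply: (@le_trans _ _ (q * enorm (grad g x) ^+ 2)).
  by rewrite ler_pM2r ?exprn_gt0 // ge_min lexx.
by rewrite le_eqVlt; apply/orP; left; apply/eqP; rewrite /q; field; rewrite !gt_eqF.
Qed.

End polyak_step.

(** * One step of stochastic gradient descent *)

(** How a bound that depends on the step-size s is made uniform over
    a <= s <= b when r has no known sign: q <= p + s * r <= s * (p / a + r), and
    q >= 0 makes the last factor nonnegative. *)
Lemma le_divD_scale (R : realType) (a s b p q r : R) :
  0 < a -> a <= s -> s <= b -> 0 <= p -> 0 <= q -> q <= p + s * r ->
  q <= b * (p / a + r).
Proof.
move=> a0 as_ sb p0 q0 qp; have s0 := lt_le_trans a0 as_.
have qs : q <= s * (p / a + r).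
  apply: (le_trans qp); rewrite mulrDr lerD2r mulrCA ler_peMr //.
  by rewrite ler_pdivlMr // mul1r.
have : 0 <= p / a + r by rewrite -(pmulr_rge0 _ s0) (le_trans q0).
by move=> h; apply: (le_trans qs); rewrite ler_wpM2r.
Qed.

Definition sgd_step (R : realType) (d n : nat) (f : 'I_n.+1 -> 'rV[R]_d -> R)
    (step : 'I_n.+1 -> 'rV[R]_d -> R) (i : 'I_n.+1) (x : 'rV[R]_d) : 'rV[R]_d :=
  x - step i x *: grad (f i) x.

Section one_step.
Context (R : realType) (d n : nat) (f : 'I_n.+1 -> 'rV[R]_d -> R).
Context (xstar : 'rV[R]_d) (mu l lm c gb : R).
Let fbar := average f.
Let step := fun i => SPSmax c gb (f i).
Let a := 1 / (2 * c * lm).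
Hypotheses (fmin : minimizer fbar xstar) (c0 : 0 < c) (gb0 : 0 < gb).
Hypotheses (lm0 : 0 < lm) (fl : forall i, quad_ub lm (f i)) (agb : a <= gb).
Hypotheses (ffin : forall i, infval (f i) \is a fin_num).
Hypotheses (l0 : 0 <= l) (llm : l <= lm) (fbarl : quad_ub l fbar).
Hypothesis df : forall i x, differentiable (f i) x.
Hypothesis fPL : PL mu fbar (fbar xstar).
Implicit Type x : 'rV[R]_d.

Lemma sgd_step_le i x :
  fbar (sgd_step f step i x) - fbar xstar <=
  gb * ((fbar x - fbar xstar) / a
        + (l / (2 * c) * (f i x - fine (infval (f i)))
           - dotv (grad (f i) x) (grad fbar x))).
Proof.
have a0 : 0 < a by rewrite divr_gt0 // !mulr_gt0.
have as_ : a <= step i x by apply: le_SPSmax.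
apply: (le_divD_scale a0 as_ (SPSmax_le _ _ _ _)); rewrite ?subr_ge0 //.
have s0 : 0 <= step i x := le_trans (ltW a0) as_.
have := fbarl x (- step i x *: grad (f i) x).
rewrite scaleNr -/(sgd_step f step i x) -scaleNr enorm_sqr !dotvZr dotvZl.
rewrite -enorm_sqr (dotvC (grad fbar x)) => h.
have : step i x * (step i x * enorm (grad (f i) x) ^+ 2) <=
    step i x * ((f i x - fine (infval (f i))) / c).
  by rewrite ler_wpM2l // SPSmax_grad_sqr.
move=> /(ler_wpM2l l0); move: h.
have -> : l / (2 * c) * (f i x - fine (infval (f i))) =
  l / 2 * ((f i x - fine (infval (f i))) / c) by rewrite invfM; ring.
by set e := _ / c; nra.
Qed.

Lemma average_sgd_step_le x :
  n.+1%:R^-1 * \sum_(i < n.+1) (fbar (sgd_step f step i x) - fbar xstar) <=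
  gb * (1 / a - 2 * mu + lm / (2 * c)) * (fbar x - fbar xstar)
  + l * sigma2r f xstar * gb / (2 * c).
Proof.
have n0 : 0 < n.+1%:R^-1 :> R by rewrite invr_gt0 ltr0n.
set D := fbar x - fbar xstar; have D0 : 0 <= D by rewrite subr_ge0.
have avg_cst (z : R) : n.+1%:R^-1 * \sum_(i < n.+1) z = z.
  by rewrite sumr_const card_ord -[z *+ _]mulr_natl mulKf // pnatr_eq0.
have gapE : n.+1%:R^-1 * \sum_(i < n.+1) (f i x - fine (infval (f i))) =
    D + sigma2r f xstar.
  rewrite /D /fbar /average /sigma2r -mulrBr -mulrDr -sumrB -big_split /=.
  by congr (_ * _); apply: eq_bigr => i _; ring.
have dotE : n.+1%:R^-1 * \sum_(i < n.+1) dotv (grad (f i) x) (grad fbar x) =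
    enorm (grad fbar x) ^+ 2.
  by rewrite -dotv_suml -dotvZl -grad_average // enorm_sqr.
apply: (@le_trans _ _ (n.+1%:R^-1 * \sum_(i < n.+1)
    (gb * (D / a + (l / (2 * c) * (f i x - fine (infval (f i)))
           - dotv (grad (f i) x) (grad fbar x)))))).
  by rewrite ler_pM2l //; apply: ler_sum => i _; exact: sgd_step_le.
rewrite -mulr_sumr mulrCA big_split sumrB /= mulrDr avg_cst.
rewrite -mulr_sumr mulrBr mulrCA gapE dotE.
have -> : gb * (1 / a - 2 * mu + lm / (2 * c)) * D + l * sigma2r f xstar * gb / (2 * c)
  = gb * (D / a + (lm / (2 * c) * D + l / (2 * c) * sigma2r f xstar - 2 * mu * D)).
  by ring.
rewrite ler_pM2l // lerD2l mulrDr lerB ?fPL // lerD2r ler_wpM2r //.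
by rewrite ler_pM2r // invr_gt0 mulr_gt0.
Qed.

End one_step.

(** * Expectation along the iterates *)

Section sgd_expectation.
Context (R : realType) (d n : nat) (f : 'I_n.+1 -> 'rV[R]_d -> R).
Context (step : 'I_n.+1 -> 'rV[R]_d -> R).
Context (disp : measure_display) (T : measurableType disp).
Context (P : probability T R) (idx : nat -> T -> 'I_n.+1) (x0 : 'rV[R]_d).
Hypothesis iid : iid_uniform P idx.
Let X k := sgd f step idx x0 k.
Implicit Types (G : 'rV[R]_d -> R) (J : seq nat) (A : nat -> set 'I_n.+1).

Let measurable_idx k (S : set 'I_n.+1) : measurable (idx k @^-1` S).
Proof. by case: iid. Qed.

Definition cylinder J A : set T := \bigcap_(j in [set` J]) (idx j @^-1` A j).

Lemma measurable_cylinder J A : measurable (cylinder J A).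
Proof. by apply: fin_bigcap_measurable => // j _; exact: measurable_idx. Qed.

(** An iterate takes finitely many values, each on a measurable set, so every
    preimage is measurable, even for a discontinuous step-size. *)
Lemma measurable_sgd k (S : set 'rV[R]_d) : measurable (X k @^-1` S).
Proof.
elim: k S => [|k IH] S.
  have [x0S|x0S] := pselect (S x0).
    by rewrite (_ : _ @^-1` _ = setT) //; apply/seteqP; split.
  by rewrite (_ : _ @^-1` _ = set0) //; apply/seteqP; split.
rewrite (_ : _ @^-1` _ = \bigcup_(i in [set: 'I_n.+1])
    (idx k @^-1` [set i] `&` X k @^-1` (sgd_step f step i @^-1` S))).
  by apply: fin_bigcup_measurable => // i _; exact: measurableI.
apply/seteqP; split => [w Sw|w [i _ [/= <-]]//].
by exists (idx k w).
Qed.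

Lemma measurable_fun_sgd G k (D : set T) : measurable D ->
  measurable_fun D ((fun w => (G (X k w))%:E) : T -> \bar R).
Proof.
move=> mD _ Y _; apply: measurableI => //.
exact: (measurable_sgd k ((fun x => (G x)%:E) @^-1` Y)).
Qed.

Lemma integral_idx_split k (B : set T) (h : T -> \bar R) :
  measurable B -> measurable_fun B h -> (forall w, (0 <= h w)%E) ->
  (\int[P]_(w in B) h w =
   \sum_(i < n.+1) \int[P]_(w in B `&` idx k @^-1` [set i]) h w)%E.
Proof.
move=> mB mh h0; have BE :
    B = \big[setU/set0]_(i < n.+1) (B `&` idx k @^-1` [set i]).
  rewrite -bigcup_seq; apply/seteqP; split => [w Bw|w [i _ []]//].
  by exists (idx k w) => //=; exact: mem_index_enum.
rewrite {1}BE ge0_integral_bigsetU //.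
- by move=> i; exact: measurableI.
- exact: index_enum_uniq.
- by move=> i j _ _ [w [[_ /= <-] [_ /= <-]]].
- by rewrite -BE.
Qed.

(** Adding a constraint on a fresh index to a cylinder gives a cylinder, so that
    inductions over cylinders can continue, and divides the probability by the
    number of indices. *)
Lemma probability_cylinderI J A k i : uniq J -> k \notin J ->
  (P (cylinder J A `&` idx k @^-1` [set i]) =
   P (cylinder J A) * (n.+1%:R^-1)%:E)%E /\
  exists A', cylinder J A `&` idx k @^-1` [set i] = cylinder (k :: J) A'.
Proof.
move=> uJ kJ; case: iid => _ unif indep.
pose A' j := if j == k then [set i] else A j.
have A'J j : j \in J -> A' j = A j.
  by rewrite /A'; case: eqP => // ->; rewrite (negbTE kJ).
have E : cylinder J A `&` idx k @^-1` [set i] = cylinder (k :: J) A'.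
  apply/seteqP; split => w /=.
    move=> [JAw ikw] j /=; rewrite inE => /orP[/eqP ->|jJ].
      by rewrite /A' eqxx.
    by rewrite A'J //; exact: JAw.
  move=> h; split.
    by move=> j /= jJ; rewrite -A'J //; apply: h => /=; rewrite inE jJ orbT.
  have := h k; rewrite /A' eqxx; apply; exact: mem_head.
split; last by exists A'.
rewrite E /cylinder indep /= ?kJ // indep // big_cons {1}/A' eqxx unif muleC.
congr (_ * _)%E; apply: eq_big_seq => j jJ; by rewrite A'J.
Qed.

(** Independence of the k-th iterate from the indices k, k+1, ..., quantified
    over all observables [G], since the induction on k replaces [G] by its
    composition with a step. *)
Definition iterate_indep_future k := forall G J A, (forall x, 0 <= G x) -> uniq J ->
  (forall j, j \in J -> (k <= j)%N) ->
  (\int[P]_(w in cylinder J A) (G (X k w))%:E =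
   P (cylinder J A) * \int[P]_w (G (X k w))%:E)%E.

(** Split the cylinder according to the value i of the k-th index.  On each piece
    the iterate k+1 is the step i applied to the iterate k, and the piece is a
    cylinder about indices from k on, so independence at time k applies. *)
Lemma integral_sgdS k G J A : iterate_indep_future k ->
  (forall x, 0 <= G x) -> uniq J -> (forall j, j \in J -> (k < j)%N) ->
  (\int[P]_(w in cylinder J A) (G (X k.+1 w))%:E =
   P (cylinder J A) *
   \sum_(i < n.+1) (n.+1%:R^-1)%:E *
     \int[P]_w (G (sgd_step f step i (X k w)))%:E)%E.
Proof.
move=> IH G0 uJ Jk; have kJ : k \notin J.
  by apply/negP => /Jk; rewrite ltnn.
have mJ := measurable_cylinder J A.
rewrite (integral_idx_split k) //; last 2 first.
- exact: measurable_fun_sgd.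
- by move=> w; rewrite lee_fin.
rewrite ge0_sume_distrr; last first.
  by move=> i _; rewrite mule_ge0 ?lee_fin ?invr_ge0 // integral_ge0 // => w _;
    rewrite lee_fin.
apply: eq_bigr => i _.
have [PE [A' E]] := probability_cylinderI A i uJ kJ.
rewrite (eq_integral (fun w => (G (sgd_step f step i (X k w)))%:E)); last first.
  by move=> w; rewrite inE => -[_ /= ikw]; rewrite /X /= ikw.
rewrite muleA -PE E (IH (G \o sgd_step f step i)) //=; last first.
  by move=> j; rewrite inE => /orP[/eqP ->//|/Jk /ltnW].
by rewrite kJ.
Qed.

Lemma integral_sgdS_setT k G : iterate_indep_future k -> (forall x, 0 <= G x) ->
  (\int[P]_w (G (X k.+1 w))%:E =
   \sum_(i < n.+1) (n.+1%:R^-1)%:E *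
     \int[P]_w (G (sgd_step f step i (X k w)))%:E)%E.
Proof.
move=> IH G0; have := @integral_sgdS k G [::] (fun=> setT) IH G0 isT.
rewrite (_ : cylinder _ _ = setT); last by apply/seteqP; split.
by rewrite probability_setT mul1e; apply.
Qed.

(** The right-hand side of [integral_sgdS] depends on the cylinder only through
    its probability, which is the independence at time k+1. *)
Lemma sgd_iterate_indep_future k : iterate_indep_future k.
Proof.
elim: k => [|k IH] G J A G0 uJ Jk.
  have int0 (D : set T) : measurable D ->
      (\int[P]_(w in D) (G (X 0 w))%:E = (G x0)%:E * P D)%E.
    exact: (@integral_cst _ _ _ P D ^~ (G x0)%:E).
  rewrite !int0 ?probability_setT ?mule1 1?muleC //.
  exact: measurable_cylinder.
by rewrite integral_sgdS // integral_sgdS_setT.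
Qed.

Lemma expectation_sgdS k G : (forall x, 0 <= G x) ->
  ('E_P[G \o X k.+1] =
   'E_P[(fun x => n.+1%:R^-1 * \sum_(i < n.+1) G (sgd_step f step i x))%R
        \o X k])%E.
Proof.
move=> G0; rewrite unlock (integral_sgdS_setT (@sgd_iterate_indep_future k)) //.
pose GT i := G \o sgd_step f step i.
under eq_bigr => i _.
  rewrite -ge0_integralZl_EFin ?invr_ge0 //; last first.
  - exact: (measurable_fun_sgd (GT i)).
  - by move=> w _; rewrite lee_fin.
  over.
rewrite /= -ge0_integral_sum //; last 2 first.
- move=> i; apply: measurable_funeM; exact: (measurable_fun_sgd (GT i)).
- by move=> i w _; rewrite mule_ge0 ?lee_fin ?invr_ge0.
apply: eq_integral => w _ /=.
by rewrite mulr_sumr -sumEFin; apply: eq_bigr => i _; rewrite EFinM.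
Qed.

Lemma expectation_sgd_affine k G (a b : R) : (forall x, 0 <= G x) ->
  0 <= a -> 0 <= b ->
  (forall x, n.+1%:R^-1 * \sum_(i < n.+1) G (sgd_step f step i x) <= a * G x + b) ->
  ('E_P[G \o X k.+1] <= a%:E * 'E_P[G \o X k] + b%:E)%E.
Proof.
move=> G0 a0 b0 h; rewrite expectation_sgdS // unlock.
have integralb : (\int[P]_w cst b%:E w = b%:E)%E.
  by have := expectation_cst P b; rewrite unlock.
have -> : (a%:E * \int[P]_w (G (X k w))%:E + b%:E =
    \int[P]_w ((a%:E * (G (X k w))%:E) + (cst b%:E w)))%E.
  rewrite ge0_integralD //.
  - rewrite integralb ge0_integralZl_EFin //.
    + by move=> w _; rewrite lee_fin.
    + exact: measurable_fun_sgd.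
  - by move=> w _; rewrite mule_ge0 ?lee_fin.
  - by apply: measurable_funeM; exact: measurable_fun_sgd.
apply: ge0_le_integral => //=.
- by move=> w _; rewrite lee_fin mulr_ge0 ?invr_ge0 ?sumr_ge0.
- exact: (measurable_fun_sgd
    (fun x => n.+1%:R^-1 * \sum_(i < n.+1) G (sgd_step f step i x))).
- exact: (measurable_fun_sgd (fun x => a * G x + b)).
- by move=> w _; rewrite lee_fin.
Qed.

Lemma expectation_sgd_le k G (a b : R) : (forall x, 0 <= G x) ->
  0 <= a -> 0 <= b ->
  (forall x, n.+1%:R^-1 * \sum_(i < n.+1) G (sgd_step f step i x) <= a * G x + b) ->
  ('E_P[G \o X k] <= (a ^+ k * G x0 + b * \sum_(j < k) a ^+ j)%:E)%E.
Proof.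
move=> G0 a0 b0 h; elim: k => [|k IH].
  by rewrite (_ : _ \o _ = cst (G x0)) // expectation_cst big_ord0 mulr0 addr0 mul1r.
apply: (le_trans (expectation_sgd_affine k G0 a0 b0 h)).
apply: (@le_trans _ _ (a%:E * (a ^+ k * G x0 + b * \sum_(j < k) a ^+ j)%:E + b%:E)%E).
  by rewrite leeD2r // lee_wpmul2l // lee_fin.
rewrite -EFinM -EFinD lee_fin le_eqVlt; apply/orP; left; apply/eqP.
rewrite exprS big_ord_recl expr0.
under [in RHS]eq_bigr => j _ do rewrite lift0 exprS.
rewrite -mulr_sumr; ring.
Qed.

End sgd_expectation.

(** * Convergence *)

Lemma sum_expr_le (R : realType) (a : R) (k : nat) :
  0 <= a < 1 -> \sum_(j < k) a ^+ j <= (1 - a)^-1.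
Proof.
move=> /andP[a0 a1]; have b0 : 0 < 1 - a by rewrite subr_gt0.
rewrite -[leRHS]mul1r ler_pdivlMr // mulrC.
have := subrX1 a k; have := exprn_ge0 k a0; lra.
Qed.

Theorem theorem3p6 (R : realType) (d n : nat)
    (f : 'I_n.+1 -> 'rV[R]_d -> R) (xstar : 'rV[R]_d)
    (mu L : R) (Ls : 'I_n.+1 -> R) (c gb : R)
    (disp : measure_display) (T : measurableType disp) (P : probability T R)
    (idx : nat -> T -> 'I_n.+1) (x0 : 'rV[R]_d) :
  let fbar := average f in
  let Lmax := maxL Ls in
  let alpha := Num.min (1 / (2 * c * Lmax)) gb in
  let nu := gb * (1 / alpha - 2 * mu + Lmax / (2 * c)) in
  minimizer fbar xstar ->
  sigma2 f xstar \is a fin_num ->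
  0 < mu ->
  PL mu fbar (fbar xstar) ->
  smooth L fbar ->
  (forall i, smooth (Ls i) (f i)) ->
  0 < c -> 0 < gb ->
  Lmax / (4 * mu) < c ->
  1 / (2 * c * Lmax) <= gb ->
  0 < nu <= 1 ->
  iid_uniform P idx ->
  forall k : nat,
  ('E_P[(fun w : T =>
           fbar (sgd f (fun i => SPSmax c gb (f i)) idx x0 k w) - fbar xstar)%R]
   <= (nu ^+ k * (fbar x0 - fbar xstar))%:E
      + (L%:E * sigma2 f xstar * gb%:E) / (2 * (1 - nu) * c)%:E)%E.
Proof.
move=> fbar Lmax alpha nu fmin sfin mu0 fPL fL fLs c0 gb0 _ agb /andP[nu0 nu1].
move=> iid k; have ffin := sigma2_fin_num sfin.
have gap0 := sigma2r_ge0 xstar ffin.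
have alphaE : alpha = 1 / (2 * c * Lmax) by rewrite /alpha min_l.
(* A nonpositive Lmax would make nu negative. *)
have Lmax0 : 0 < Lmax.
  rewrite ltNge; apply/negP => Lmax0; move: nu0; apply/negP; rewrite -leNgt.
  have h : Lmax / (2 * c) <= 0.
    by rewrite mulr_le0_ge0 // invr_ge0 mulr_ge0 // ltW.
  rewrite /nu alphaE !div1r invrK pmulr_rle0 //; nra.
have fm i : quad_ub Lmax (f i).
  exact: quad_ub_le (le_bigmax _ _ i) (smooth_quad_ub (fLs i)).
have df i x : differentiable (f i) x by case: (fLs i).
have [l [l0 lLmax fbarl lL]] := exists_quad_ub_average Lmax0
  (average_quad_ub fm df) fL gap0.
pose b := l * sigma2r f xstar * gb / (2 * c).
have lgap0 := mulr_ge0 l0 gap0.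
have b0 : 0 <= b.
  apply: divr_ge0; apply: mulr_ge0 => //; exact: ltW.
have step x := average_sgd_step_le fmin c0 gb0 Lmax0 fm agb ffin l0 lLmax fbarl
  df fPL x.
rewrite -/fbar -alphaE -/nu -/b in step.
have D0 x : 0 <= fbar x - fbar xstar by rewrite subr_ge0.
apply: (le_trans (expectation_sgd_le x0 iid k D0 (ltW nu0) b0 step)).
rewrite EFinD leeD2l // sigma2E // -!EFinM inver.
(* The residual is divided by zero exactly when nu = 1. *)
case: ifPn => [/eqP nuE|nuN].
  have [Lgap0|Lgap0] := leP (L * sigma2r f xstar) 0.
    have -> : b = 0.
      have -> : b = (l * sigma2r f xstar) * (gb / (2 * c)) by rewrite mulrA.
      have -> : l * sigma2r f xstar = 0; last by rewrite mul0r.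
      by apply/eqP; rewrite eq_le (le_trans lL Lgap0) lgap0.
    rewrite mul0r; have -> : L * sigma2r f xstar = 0.
      by apply/eqP; rewrite eq_le Lgap0 (le_trans lgap0 lL).
    by rewrite mul0r mul0e.
  by rewrite gt0_muley ?leey // lte_fin mulr_gt0.
have nu_lt1 : nu < 1.
  rewrite lt_neqAle nu1 andbT; apply: contra nuN => /eqP ->.
  by rewrite subrr mulr0 mul0r.
rewrite -EFinM; have -> : L * sigma2r f xstar * gb / (2 * (1 - nu) * c) =
    L * sigma2r f xstar * gb / (2 * c) / (1 - nu).
  by rewrite -[RHS]mulrA -invfM [2 * c * _]mulrAC.
rewrite lee_fin ler_pM ?sumr_ge0 //.
- by move=> j _; rewrite exprn_ge0 // ltW.
- by rewrite ler_pM2r ?invr_gt0 ?mulr_gt0 // ler_pM2r.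
- by apply: sum_expr_le; rewrite ltW.
Qed.
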